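(* Fix $n\ge1$ and assume that $$\frac{\alpha}{\mathsf p}+\frac{\gamma}{\mathsf q}=1,\qquad \frac{\beta}{\mathsf p}+\frac{\delta}{\mathsf q}=1;$$ set $\rho_0=\alpha/\mathsf p$ and $\rho_\ell=\delta/\mathsf q$. Then the generator $\mathscr L^{\mathrm{seg}}$ of open ASEP on a segment and the operator $\mathscr D^{(n,\rho_0,\rho_\ell)}$ are dual with respect to $$H(\eta,N_\ell;\vec x)=\prod_{i=1}^nQ_{x_i}(\eta,N_\ell),$$ i.e. for every $(\eta,N_\ell)\in\{0,1\}^{\{1,\dots,\ell-1\}}\times\mathbb Z$ and every $\vec x\in\mathbb W^n_{[1,\ell]}$, $$\mathscr L^{\mathrm{seg}}H(\eta,N_\ell;\vec x)=\mathscr D^{(n,\rho_0,\rho_\ell)}H(\eta,N_\ell;\vec x),$$ where $\mathscr L^{\mathrm{seg}}$ acts on functions of $(\eta,N_\ell)$ and $\mathscr D^{(n,\rho_0,\rho_\ell)}$ acts on functions of $\vec x$.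
   Context: Parameters: an integer $\ell\ge2$, real numbers $\mathsf p>\mathsf q>0$ and $\alpha,\beta,\gamma,\delta\ge0$; $q:=\mathsf q/\mathsf p\in(0,1)$. Open ASEP on a segment: the Markov process on states $(\eta,N)$, $\eta\in\{0,1\}^{\{1,\dots,\ell-1\}}$, $N=N_\ell\in\mathbb Z$ ($N_\ell$ counts particles annihilated at site $\ell-1$ to the right reservoir minus particles created there), with generator $$\begin{aligned}\mathscr L^{\mathrm{seg}}f(\eta,N)={}&\alpha(1-\eta_1)\big(f(\eta_1^+,N)-f(\eta,N)\big)+\gamma\eta_1\big(f(\eta_1^-,N)-f(\eta,N)\big)\\ &+\delta(1-\eta_{\ell-1})\big(f(\eta_{\ell-1}^+,N-1)-f(\eta,N)\big)+\beta\eta_{\ell-1}\big(f(\eta_{\ell-1}^-,N+1)-f(\eta,N)\big)\\ &+\sum_{x=1}^{\ell-2}\big(\mathsf p\,\eta_x(1-\eta_{x+1})+\mathsf q\,\eta_{x+1}(1-\eta_x)\big)\big(f(\eta^{x,x+1},N)-f(\eta,N)\big),\end{aligned}$$ where $\eta_i^{+}$ (resp. $\eta_i^-$) is $\eta$ with $\eta_i$ set to $1$ (resp. $0$) and $\eta^{x,x+1}$ is $\eta$ with $\eta_x,\eta_{x+1}$ exchanged. For $1\le x\le\ell$: $N_x(\eta,N_\ell)=\sum_{i=x}^{\ell-1}\eta_i+N_\ell$ and $Q_x(\eta,N_\ell)=q^{N_x(\eta,N_\ell)}$. $\mathbb W^n_{[1,\ell]}=\{\vec x\in\mathbb Z^n:1\le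 x_1<\dots<x_n\le\ell\}$, $\vec x_i^\pm=(x_1,\dots,x_i\pm1,\dots,x_n)$. For $f:\mathbb W^n_{[1,\ell]}\to\mathbb R$, $$\begin{aligned}\mathscr D^{(n,\rho_0,\rho_\ell)}f(\vec x)={}&\sum_{\substack{2\le i\le n\\ x_i-x_{i-1}>1}}\mathsf p\big(f(\vec x_i^-)-f(\vec x)\big)+\sum_{\substack{1\le i\le n-1\\ x_{i+1}-x_i>1}}\mathsf q\big(f(\vec x_i^+)-f(\vec x)\big)\\ &+\mathbf 1_{x_1>1}\mathsf p\big(f(\vec x_1^-)-f(\vec x)\big)-\mathbf 1_{x_1=1}(\mathsf p-\mathsf q)\rho_0f(\vec x)\\ &+\mathbf 1_{x_n<\ell}\,\mathsf q\big(f(\vec x_n^+)-f(\vec x)\big)+\mathbf 1_{x_n=\ell}(\mathsf p-\mathsf q)\rho_\ell f(\vec x).\end{aligned}$$ *)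

(* Defs.v *)
From HB Require Import structures.
From mathcomp Require Import all_boot all_order all_algebra.
From mathcomp Require Import reals.
From mathcomp Require Import zify.

Set Implicit Arguments.
Unset Strict Implicit.
Unset Printing Implicit Defensive.

Import Order.TTheory GRing.Theory Num.Theory.
Local Open Scope ring_scope.

(* Sites 1, ..., l - 1 and coordinates 1, ..., n are numbered from 1, so that  *)
(* number i is stored at position i.-1 of the corresponding tuple.            *)

(** Open ASEP on the segment with sites 1, ..., l - 1 *)

Definition config (l : nat) : Type := (l.-1).-tuple bool.

Definition state (l : nat) : Type := (config l * int)%type.

Definition occ (l : nat) (eta : config l) (x : nat) : bool :=
  nth false eta x.-1.

Definition set_occ (l : nat) (eta : config l) (x : nat) (b : bool) : config l :=
  [tuple if j.+1 == x then b else occ eta j.+1 | j < l.-1].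

Definition swap_occ (l : nat) (eta : config l) (x : nat) : config l :=
  [tuple if j.+1 == x then occ eta x.+1
         else if j.+1 == x.+1 then occ eta x else occ eta j.+1 | j < l.-1].

Definition Lseg (R : realType) (l : nat) (p q alpha beta gamma delta : R)
    (f : state l -> R) (s : state l) : R :=
  let: (eta, N) := s in
  let e (x : nat) : R := (occ eta x)%:R in
    alpha * (1 - e 1%N) * (f (set_occ eta 1 true, N) - f (eta, N))
  + gamma * e 1%N * (f (set_occ eta 1 false, N) - f (eta, N))
  + delta * (1 - e l.-1) * (f (set_occ eta l.-1 true, N - 1) - f (eta, N))
  + beta * e l.-1 * (f (set_occ eta l.-1 false, N + 1) - f (eta, N))
  + \sum_(1 <= x < l.-1)
      (p * e x * (1 - e x.+1) + q * e x.+1 * (1 - e x))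
      * (f (swap_occ eta x, N) - f (eta, N)).

(* The position x is an integer because it will be a coordinate of a point of *)
(* Z^n; for 1 <= x <= l the sum runs over the sites x, ..., l - 1.            *)
Definition Nx (l : nat) (s : state l) (x : int) : int :=
  \sum_(1 <= i < l | x <= i%:Z) (occ s.1 i)%:R + s.2.

Definition Qx (R : realType) (l : nat) (p q : R) (s : state l) (x : int) : R :=
  (q / p) ^ Nx s x.

(** The space W^n_[1,l] and the dual operator *)

Definition in_weyl (n l : nat) (x : n.-tuple int) : bool :=
  sorted <%R x && all (fun a : int => 1 <= a <= l%:Z) x.

Definition weyl (n l : nat) : Type := {x : n.-tuple int | in_weyl l x}.

Definition coord (n : nat) (x : n.-tuple int) (i : nat) : int := x`_i.-1.

Definition shift (n : nat) (x : n.-tuple int) (i : nat) (e : int) :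
    n.-tuple int :=
  [tuple if j.+1 == i then coord x i + e else coord x j.+1 | j < n].

(* x_i^- and x_i^+ as points of W^n_[1,l]. When the shifted point leaves      *)
(* W^n_[1,l] the value is the default x, but Dop only uses moves that stay in *)
(* W^n_[1,l], see val_move_left and val_move_right.                         *)
Definition move_left (n l : nat) (x : weyl n l) (i : nat) : weyl n l :=
  insubd x (shift (val x) i (-1)).

Definition move_right (n l : nat) (x : weyl n l) (i : nat) : weyl n l :=
  insubd x (shift (val x) i 1).

Definition Dop (R : realType) (n l : nat) (p q rho0 rhol : R)
    (f : weyl n l -> R) (x : weyl n l) : R :=
  let c := coord (val x) in
    \sum_(2 <= i < n.+1 | 1 < c i - c i.-1) p * (f (move_left x i) - f x)
  + \sum_(1 <= i < n | 1 < c i.+1 - c i) q * (f (move_right x i) - f x)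
  + (if 1 < c 1%N then p * (f (move_left x 1) - f x) else 0)
  - (if c 1%N == 1 then (p - q) * rho0 * f x else 0)
  + (if c n < l%:Z then q * (f (move_right x n) - f x) else 0)
  + (if c n == l%:Z then (p - q) * rhol * f x else 0).

Lemma in_weylP (n l : nat) (x : n.-tuple int) :
  reflect ((forall i : nat, (0 < i < n)%N -> coord x i < coord x i.+1) /\
           (forall i : nat, (0 < i <= n)%N -> 1 <= coord x i <= l%:Z))
          (in_weyl l x).
Proof.
apply: (iffP andP) => -[].
  move=> /(sortedP 0) xS /(all_nthP 0) xB; split=> -[//|i] /=.
    by move=> lt_in; apply: xS; rewrite size_tuple.
  by move=> lt_in; apply: xB; rewrite size_tuple.
move=> xS xB; split.
  by apply/(sortedP 0) => i; rewrite size_tuple => lt_in; apply: (xS i.+1).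
by apply/(all_nthP 0) => i; rewrite size_tuple => lt_in; apply: (xB i.+1).
Qed.

Lemma coord_shift (n : nat) (x : n.-tuple int) (i k : nat) (e : int) :
  (0 < k <= n)%N ->
  coord (shift x i e) k = if k == i then coord x i + e else coord x k.
Proof.
case: k => // k /= lt_kn.
by rewrite {1}/coord /= (nth_mktuple _ 0 (Ordinal lt_kn)).
Qed.

Lemma val_move_left (n l : nat) (x : weyl n l) (i : nat) :
  (0 < i <= n)%N ->
  (if i == 1%N then 1 < coord (val x) 1
   else 1 < coord (val x) i - coord (val x) i.-1) ->
  val (move_left x i) = shift (val x) i (-1).
Proof.
move=> iB gap; rewrite val_insubd ifT //; case: x gap => x /= /in_weylP[xS xB].
move=> gap; apply/in_weylP; split=> k kB; rewrite !coord_shift; try lia.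
  have := xS k kB; case: (eqVneq k i) => [-> | ki]; first by rewrite ifF; lia.
  case: (eqVneq k.+1 i) => [ki1 | //]; move: gap; rewrite -ki1 /=.
  by rewrite ifF; lia.
have := xB k kB; case: (eqVneq k i) => [-> | //].
move: gap; case: (eqVneq i 1%N) => [-> | i1] gap; first lia.
have := xB i.-1; lia.
Qed.

Lemma val_move_right (n l : nat) (x : weyl n l) (i : nat) :
  (0 < i <= n)%N ->
  (if i == n then coord (val x) n < l%:Z
   else 1 < coord (val x) i.+1 - coord (val x) i) ->
  val (move_right x i) = shift (val x) i 1.
Proof.
move=> iB gap; rewrite val_insubd ifT //; case: x gap => x /= /in_weylP[xS xB].
move=> gap; apply/in_weylP; split=> k kB; rewrite !coord_shift; try lia.
  have := xS k kB; case: (eqVneq k i) => [ki | ki].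
    by move: gap; rewrite -ki !ifF; lia.
  by case: (eqVneq k.+1 i) => [<- | //]; lia.
have := xB k kB; case: (eqVneq k i) => [-> | //].
move: gap; case: (eqVneq i n) => [-> | i_n] gap; first lia.
have := xB i.+1; lia.
Qed.

(** The duality function *)

Definition Hdual (R : realType) (n l : nat) (p q : R) (s : state l)
    (x : weyl n l) : R :=
  \prod_(1 <= i < n.+1) Qx p q s (coord (val x) i).

(* Main.v *)
(** With t = q / p, each elementary transition of the process changes exactly
    one of the heights N_1, ..., N_l.  Put g = eta on the sites, g(0) = rho_0
    and g(l) = rho_l.  The transitions changing N_z multiply H by
    (p - q) (g(z) - g(z - 1)) if z is a coordinate of x and by 0 otherwise, the
    two boundary relations being what is needed for z = 1 and z = l.  On the
    other side, moving x_i left, resp. right, contributes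
    - (p - q) g(x_i - 1), resp. (p - q) g(x_i), and for adjacent coordinates
    the two suppressed contributions cancel, since x_i = x_{i+1} - 1. *)
Require Import Defs.
From mathcomp Require Import all_boot all_order all_algebra.
From mathcomp Require Import reals.
From mathcomp Require Import zify ring.
Import Defs. (* so that [coord] is not the one of [vector] *)

Set Implicit Arguments.
Unset Strict Implicit.

Import Order.TTheory GRing.Theory Num.Theory.
Local Open Scope ring_scope.

(** * Occupations and heights after an elementary transition *)

Lemma occ_set_occ (l : nat) (eta : config l) (x : nat) (b : bool) (y : nat) :
  (0 < y < l)%N ->
  occ (set_occ eta x b) y = if y == x then b else occ eta y.
Proof.
case: y => // y /= lt_yl; have lt_y : (y < l.-1)%N by lia.
by rewrite {1}/occ /= (nth_mktuple _ false (Ordinal lt_y)).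
Qed.

Lemma occ_swap_occ (l : nat) (eta : config l) (x y : nat) :
  (0 < y < l)%N ->
  occ (swap_occ eta x) y =
    if y == x then occ eta x.+1
    else if y == x.+1 then occ eta x else occ eta y.
Proof.
case: y => // y /= lt_yl; have lt_y : (y < l.-1)%N by lia.
by rewrite {1}/occ /= (nth_mktuple _ false (Ordinal lt_y)).
Qed.

Lemma Nx_right (l : nat) (s : state l) : Nx s l%:Z = s.2.
Proof.
rewrite /Nx big_nat_cond big_pred0 ?add0r // => i.
by lia.
Qed.

Lemma Nx_step (l : nat) (s : state l) (y : nat) :
  (0 < y < l)%N -> Nx s y%:Z = (occ s.1 y)%:R + Nx s y.+1%:Z.
Proof.
move=> yB; rewrite /Nx addrA; congr (_ + _).
rewrite big_mkcond (bigD1_seq y) ?mem_index_iota ?iota_uniq //= lexx.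
rewrite -big_mkcondr; congr (_ + _).
by apply: eq_bigl => i; lia.
Qed.

(** Since [occ] at [y] is [N_y - N_{y+1}], changing [N_z] alone by [d] amounts to adding [d] at site
    [z] and removing it at site [z - 1]; for [z = l] the counter [s.2] stands in for site [z]. *)
Lemma Nx_change (l : nat) (s s' : state l) (z : nat) (d : int) :
  s'.2 = s.2 + (l == z)%:R * d ->
  (forall y, (0 < y < l)%N ->
    (occ s'.1 y)%:R = (occ s.1 y)%:R + ((y == z)%:R - (y.+1 == z)%:R) * d) ->
  forall y : nat, (0 < y <= l)%N -> Nx s' y%:Z = Nx s y%:Z + (y == z)%:R * d.
Proof.
move=> sN socc y yB.
(* Induction on [k = l - y], leftwards from [N_l], as [Nx_step] expresses [N_y] through
   [N_{y+1}]. *)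
have [k le_kl {y yB}->] : exists2 k, (k < l)%N & y = (l - k)%N.
  by exists (l - y)%N; lia.
elim: k le_kl => [|k IHk] lt_kl; first by rewrite subn0 !Nx_right.
have kB : (0 < l - k.+1 < l)%N by lia.
have ek : (l - k.+1).+1 = (l - k)%N by lia.
rewrite !(Nx_step _ kB) socc // ek IHk; last lia.
by ring.
Qed.

Lemma big_pred1_uniq (T : Type) (idx : T) (op : Monoid.law idx) (I : eqType)
    (r : seq I) (i : I) (F : I -> T) :
  uniq r ->
  \big[op/idx]_(j <- r | j == i) F j = if i \in r then F i else idx.
Proof.
move=> r_uniq; rewrite -big_filter; case: ifPn => ir.
  by rewrite (filter_pred1_uniq r_uniq ir) big_seq1.
rewrite (_ : [seq j <- r | j == i] = [::]) ?big_nil //.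
by apply/eqP; rewrite -[_ == _]negbK -has_filter has_pred1.
Qed.

(** * The duality function under height changes and coordinate shifts *)

Section Duality.

Variables (R : realType) (n l : nat) (p q : R).
Hypotheses (q_gt0 : 0 < q) (p_gt0 : 0 < p).

Let t := q / p.
Let t_neq0 : t != 0.
Proof. by rewrite mulf_neq0 ?invr_eq0 ?gt_eqF. Qed.

Lemma weyl_uniq (x : weyl n l) : uniq (val x).
Proof. by case: x => x /= /andP[/lt_sorted_uniq]. Qed.

Lemma weyl_bounds (x : weyl n l) (y : int) : y \in val x -> 1 <= y <= l%:Z.
Proof. by case: x => x /= /andP[_ /allP]; apply. Qed.

Lemma big_coord (T : Type) (idx : T) (op : T -> T -> T) (x : n.-tuple int)
    (F : int -> T) :
  \big[op/idx]_(1 <= i < n.+1) F (coord x i) = \big[op/idx]_(y <- x) F y.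
Proof. by rewrite big_add1 [RHS](big_nth 0) size_tuple. Qed.

(** Prepares the comparison with [Lseg], whose transitions are grouped by the height they change.
    The coordinates are distinct and lie in [[1, l]], so each is met exactly once. *)
Lemma sum_weyl (x : weyl n l) (F : int -> R) :
  \sum_(y <- val x) F y =
  \sum_(1 <= k < l.+1) (k%:Z \in (val x : seq int))%:R * F k%:Z.
Proof.
transitivity (\sum_(y <- val x) \sum_(1 <= k < l.+1 | k == `|y|%N) F k%:Z).
  rewrite !big_seq; apply: eq_bigr => y /weyl_bounds yB.
  by rewrite big_nat1_eq ifT; [congr F; lia | lia].
under eq_bigr do rewrite big_mkcond.
rewrite exchange_big /= !big_nat; apply: eq_bigr => k kB.
rewrite -big_mkcond /=.
rewrite big_seq_cond (eq_bigl (fun y => (y \in (val x : seq int)) && (y == k%:Z))).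
  by rewrite -big_seq_cond big_pred1_uniq ?weyl_uniq // -mulrb mulr_natl.
by move=> y /=; case: (boolP (y \in _)) => //= /weyl_bounds; lia.
Qed.

(** As the coordinates are distinct, [Q_z] is a factor of [Hdual] at most once, and that factor
    alone is multiplied by [t ^ d]. *)
Lemma Hdual_change (x : weyl n l) (s s' : state l) (z : nat) (d : int) :
  s'.2 = s.2 + (l == z)%:R * d ->
  (forall y, (0 < y < l)%N ->
    (occ s'.1 y)%:R = (occ s.1 y)%:R + ((y == z)%:R - (y.+1 == z)%:R) * d) ->
  Hdual p q s' x - Hdual p q s x =
  (z%:Z \in (val x : seq int))%:R * (t ^ d - 1) * Hdual p q s x.
Proof.
move=> sN socc.
suff -> : Hdual p q s' x =
    Hdual p q s x * (if z%:Z \in (val x : seq int) then t ^ d else 1).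
  by case: ifP => _; rewrite ?mulr1 ?mul1r ?mul0r ?subrr // mulrBl mul1r mulrC.
rewrite /Hdual !(big_coord _ _ _ (Qx p q _)).
have -> : (if z%:Z \in (val x : seq int) then t ^ d else 1) =
    \prod_(y <- val x) (if y == z%:Z then t ^ d else 1).
  by rewrite -big_mkcond /= big_pred1_uniq ?weyl_uniq.
rewrite -big_split /= !big_seq; apply: eq_bigr => y /weyl_bounds yB.
have [k kB ->] : exists2 k : nat, (0 < k <= l)%N & y = k%:Z.
  by exists `|y|%N; lia.
rewrite /Qx (Nx_change sN socc) // expfzDr //; congr (_ * _).
by rewrite eqz_nat; case: eqP => _; rewrite ?mul1r ?mul0r.
Qed.

Lemma Hdual_shift (x x' : weyl n l) (s : state l) (i : nat) (e : int) :
  (0 < i <= n)%N -> val x' = shift (val x) i e ->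
  Hdual p q s x' =
  Hdual p q s x * t ^ (Nx s (coord (val x) i + e) - Nx s (coord (val x) i)).
Proof.
move=> iB xx'; rewrite /Hdual xx'.
have iS : i \in index_iota 1 n.+1 by rewrite mem_index_iota; lia.
rewrite !(bigD1_seq i iS) ?iota_uniq //= coord_shift // eqxx.
rewrite mulrAC /Qx -expfzDr // addrCA subrr addr0; congr (_ * _).
rewrite big_nat_cond [RHS]big_nat_cond; apply: eq_bigr => k /andP[kB ki].
by rewrite coord_shift ?(negPf ki) //; lia.
Qed.

(** * The dual operator applied to the duality function *)

Variables (rho0 rhol : R).

(** This is [g], with the reservoirs as sites 0 and [l]. Its argument is an integer because it is
    evaluated at [x_i - 1]. *)
Definition ext_occ (eta : config l) (y : int) : R :=
  if y <= 0 then rho0 else if l%:Z <= y then rhol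
  else (occ eta `|y|%N)%:R.

Lemma ext_occ_site (eta : config l) (y : nat) :
  (0 < y < l)%N -> ext_occ eta y%:Z = (occ eta y)%:R.
Proof. by move=> yB; rewrite /ext_occ !ifF //; lia. Qed.

Lemma ext_occ0 (eta : config l) : ext_occ eta 0 = rho0.
Proof. by []. Qed.

Lemma ext_occl (eta : config l) : (0 < l)%N -> ext_occ eta l%:Z = rhol.
Proof. by move=> l_gt0; rewrite /ext_occ ifF ?lexx //; lia. Qed.

(** The factor gained is [t ^ e] with [e] the occupation of site [x_i - 1]; as [e] is 0 or 1,
    [p * (t ^ e - 1) = - (p - q) * e]. *)
Lemma move_left_rate (x : weyl n l) (s : state l) (i : nat) :
  (0 < i <= n)%N ->
  (if i == 1%N then 1 < coord (val x) 1
   else 1 < coord (val x) i - coord (val x) i.-1) ->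
  p * (Hdual p q s (move_left x i) - Hdual p q s x) =
  (p - q) * Hdual p q s x * - ext_occ s.1 (coord (val x) i - 1).
Proof.
move=> iB gap; rewrite (Hdual_shift s iB (val_move_left iB gap)).
(* Here [k = x_i - 1] is a true site: the gap gives [x_i > 1], directly for [i = 1] and through
   [x_{i-1} >= 1] otherwise. *)
have [k kB ->] : exists2 k : nat, (0 < k < l)%N & coord (val x) i = k.+1%:Z.
  case: x gap => x /= /in_weylP[_ xB] gap; exists `|coord x i - 1|%N.
    have := xB i iB; have := xB i.-1; move: gap; case: eqP => [->|]; lia.
  have := xB i iB; have := xB i.-1; move: gap; case: eqP => [->|]; lia.
have -> : k.+1%:Z - 1 = k%:Z by lia.
rewrite ext_occ_site // (Nx_step _ kB) addrK.
by case: (occ _ _); rewrite /= ?expr1z ?expr0z /t; field; rewrite ?gt_eqF.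
Qed.

(** Now the exponent is [-e] with [e] the occupation of site [x_i], and
    [q * (t ^ (-e) - 1) = (p - q) * e]. *)
Lemma move_right_rate (x : weyl n l) (s : state l) (i : nat) :
  (0 < i <= n)%N ->
  (if i == n then coord (val x) n < l%:Z
   else 1 < coord (val x) i.+1 - coord (val x) i) ->
  q * (Hdual p q s (move_right x i) - Hdual p q s x) =
  (p - q) * Hdual p q s x * ext_occ s.1 (coord (val x) i).
Proof.
move=> iB gap; rewrite (Hdual_shift s iB (val_move_right iB gap)).
have [k kB ->] : exists2 k : nat, (0 < k < l)%N & coord (val x) i = k%:Z.
  case: x gap => x /= /in_weylP[_ xB] gap; exists `|coord x i|%N.
    have := xB i iB; have := xB i.+1; move: gap; case: eqP => [->|]; lia.
  have := xB i iB; lia.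
have -> : k%:Z + 1 = k.+1%:Z by lia.
rewrite ext_occ_site // (Nx_step _ kB) opprD addrCA subrr addr0.
by case: (occ _ _); rewrite /= ?exprN1 ?oppr0 ?expr0z /t; field; rewrite ?gt_eqF.
Qed.

Lemma Dop_Hdual (s : state l) (x : weyl n l) : (0 < n)%N ->
  Dop p q rho0 rhol (fun x' => Hdual p q s x') x =
  (p - q) * Hdual p q s x *
  \sum_(y <- val x) (ext_occ s.1 y - ext_occ s.1 (y - 1)).
Proof.
move=> n_gt0; rewrite /Dop.
set c := coord (val x); set h := (p - q) * Hdual p q s x; set g := ext_occ s.1.
have [xS xB] : (forall i : nat, (0 < i < n)%N -> c i < c i.+1) /\
    (forall i : nat, (0 < i <= n)%N -> 1 <= c i <= l%:Z).
  by apply/in_weylP; exact: valP x.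
(* Left moves are reindexed so that the gap between [c i] and [c i.+1] governs both moves into
   it. *)
have -> : \sum_(2 <= i < n.+1 | 1 < c i - c i.-1)
      p * (Hdual p q s (move_left x i) - Hdual p q s x) =
    \sum_(1 <= i < n | 1 < c i.+1 - c i) h * - g (c i.+1 - 1).
  rewrite big_add1 /= big_nat_cond [RHS]big_nat_cond.
  apply: eq_bigr => i /andP[iB gap].
  by rewrite move_left_rate //; [lia | rewrite ifF //; lia].
have -> : \sum_(1 <= i < n | 1 < c i.+1 - c i)
      q * (Hdual p q s (move_right x i) - Hdual p q s x) =
    \sum_(1 <= i < n | 1 < c i.+1 - c i) h * g (c i).
  rewrite big_nat_cond [RHS]big_nat_cond.
  apply: eq_bigr => i /andP[iB gap].
  by rewrite move_right_rate //; [lia | rewrite ifF //; lia].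
(* At [c 1 = 1] the boundary term replaces the missing left move, because [g 0 = rho0]. *)
have left : (if 1 < c 1%N then
        p * (Hdual p q s (move_left x 1) - Hdual p q s x) else 0) -
      (if c 1%N == 1 then (p - q) * rho0 * Hdual p q s x else 0) =
    - (h * g (c 1%N - 1)).
  have := xB 1%N n_gt0; case: ltP => c1.
    by rewrite ifF ?subr0 => [_|]; [rewrite move_left_rate ?mulrN | lia].
  move=> c1B; have -> : c 1%N = 1 by lia.
  by rewrite eqxx subrr /g ext_occ0 /h; ring.
have right : (if c n < l%:Z then
        q * (Hdual p q s (move_right x n) - Hdual p q s x) else 0) +
      (if c n == l%:Z then (p - q) * rhol * Hdual p q s x else 0) =
    h * g (c n).
  have := xB n; rewrite n_gt0 leqnn => /(_ isT); case: ltP => cn.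
    by rewrite ifF ?addr0 => [_|]; [rewrite move_right_rate ?eqxx ?n_gt0 ?leqnn | lia].
  move=> cnB; have -> : c n = l%:Z by lia.
  by rewrite eqxx /g ext_occl /h; [ring | lia].
rewrite -!addrA [X in _ + (_ + X)]addrA left right.
rewrite -(big_coord _ _ _ (fun y => g y - g (y - 1))) -/c sumrB.
(* Detaching [g (c n)] and [g (c 1 - 1)] pairs the remaining terms as [g (c i)] with
   [g (c i.+1 - 1)], which cancel when there is no gap. *)
rewrite [X in _ * (X - _)]big_nat_recr //= [X in _ * (_ - X)]big_nat_recl //=.
have tele : \sum_(1 <= i < n) g (c i) - \sum_(1 <= i < n) g (c i.+1 - 1) =
    \sum_(1 <= i < n | 1 < c i.+1 - c i) g (c i) -
    \sum_(1 <= i < n | 1 < c i.+1 - c i) g (c i.+1 - 1).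
  rewrite -!sumrB [RHS]big_mkcond !big_nat; apply: eq_bigr => i iB.
  case: ifPn => // gap; have := xS i iB => lt_i.
  by have -> : c i.+1 - 1 = c i by [lia]; rewrite subrr.
move/eqP: tele; rewrite subr_eq => /eqP ->.
by rewrite -!mulr_sumr sumrN; ring.
Qed.

(** * The generator applied to the duality function, one height at a time *)

Lemma left_boundary_rate (alpha gamma : R) (eta : config l) (N : int)
    (x : weyl n l) :
  (2 <= l)%N -> rho0 = alpha / p -> alpha / p + gamma / q = 1 ->
  alpha * (1 - (occ eta 1)%:R) *
    (Hdual p q (set_occ eta 1 true, N) x - Hdual p q (eta, N) x) +
  gamma * (occ eta 1)%:R *
    (Hdual p q (set_occ eta 1 false, N) x - Hdual p q (eta, N) x) =
  (p - q) * Hdual p q (eta, N) x *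
  ((1%:Z \in (val x : seq int))%:R * (ext_occ eta 1 - ext_occ eta (1 - 1))).
Proof.
move=> hl eq_rho0 hleft; have p0 : p != 0 by rewrite gt_eqF.
have q0 : q != 0 by rewrite gt_eqF.
(* With [gamma = q * (1 - rho0)], creation gives [alpha * (t - 1) = (p - q) * (0 - rho0)] and
   annihilation [gamma * (t^-1 - 1) = (p - q) * (1 - rho0)]. *)
have -> : gamma = q * (1 - alpha / p) by rewrite -hleft; field; rewrite ?p0 ?q0.
rewrite subrr ext_occ0 (@ext_occ_site _ 1) // eq_rho0.
case e1: (occ eta 1); rewrite /= !(subrr, subr0, mulr0, mul0r, add0r, addr0).
  rewrite (@Hdual_change x (eta, N) _ 1%N (-1)).
  - by rewrite exprN1 /t; field; rewrite ?p0 ?q0.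
  - by rewrite /=; lia.
  - by move=> y yB /=; rewrite occ_set_occ //; case: eqP => [->|]; rewrite ?e1; lia.
rewrite (@Hdual_change x (eta, N) _ 1%N 1).
- by rewrite expr1z /t; field; rewrite ?p0 ?q0.
- by rewrite /=; lia.
- by move=> y yB /=; rewrite occ_set_occ //; case: eqP => [->|]; rewrite ?e1; lia.
Qed.

(** The changes of the counter and of site [l - 1] compensate in every [N_y] with [y < l], so only
    [N_l] moves: down at a creation, up at an annihilation. *)
Lemma right_boundary_rate (beta delta : R) (eta : config l) (N : int)
    (x : weyl n l) :
  (2 <= l)%N -> rhol = delta / q -> beta / p + delta / q = 1 ->
  delta * (1 - (occ eta l.-1)%:R) *
    (Hdual p q (set_occ eta l.-1 true, N - 1) x - Hdual p q (eta, N) x) +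
  beta * (occ eta l.-1)%:R *
    (Hdual p q (set_occ eta l.-1 false, N + 1) x - Hdual p q (eta, N) x) =
  (p - q) * Hdual p q (eta, N) x *
  ((l%:Z \in (val x : seq int))%:R *
   (ext_occ eta l%:Z - ext_occ eta (l%:Z - 1))).
Proof.
move=> hl eq_rhol hright; have p0 : p != 0 by rewrite gt_eqF.
have q0 : q != 0 by rewrite gt_eqF.
have -> : beta = p * (1 - delta / q) by rewrite -hright; field; rewrite ?p0 ?q0.
have -> : l%:Z - 1 = l.-1%:Z by lia.
rewrite ext_occl ?ext_occ_site ?eq_rhol; [|lia|lia].
case el: (occ eta l.-1); rewrite /= !(subrr, subr0, mulr0, mul0r, add0r, addr0).
  rewrite (@Hdual_change x (eta, N) _ l 1).
  - by rewrite expr1z /t; field; rewrite ?p0 ?q0.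
  - by rewrite eqxx /= mul1r.
  - by move=> y yB /=; rewrite occ_set_occ //; case: eqP => [->|]; rewrite ?el; lia.
rewrite (@Hdual_change x (eta, N) _ l (-1)).
- by rewrite exprN1 /t; field; rewrite ?p0 ?q0.
- by rewrite eqxx /= mul1r.
- by move=> y yB /=; rewrite occ_set_occ //; case: eqP => [->|]; rewrite ?el; lia.
Qed.

Lemma bulk_rate (eta : config l) (N : int) (x : weyl n l) (k : nat) :
  (0 < k < l.-1)%N ->
  (p * (occ eta k)%:R * (1 - (occ eta k.+1)%:R)
   + q * (occ eta k.+1)%:R * (1 - (occ eta k)%:R)) *
    (Hdual p q (swap_occ eta k, N) x - Hdual p q (eta, N) x) =
  (p - q) * Hdual p q (eta, N) x *
  ((k.+1%:Z \in (val x : seq int))%:R *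
   (ext_occ eta k.+1%:Z - ext_occ eta (k.+1%:Z - 1))).
Proof.
move=> kB; have p0 : p != 0 by rewrite gt_eqF.
have q0 : q != 0 by rewrite gt_eqF.
have -> : k.+1%:Z - 1 = k%:Z by lia.
rewrite !ext_occ_site; [|lia|lia].
(* This increment of [N_{k+1}] covers all four local configurations; it vanishes, like the rate,
   when the two sites agree. *)
rewrite (@Hdual_change x (eta, N) _ k.+1 ((occ eta k)%:R - (occ eta k.+1)%:R)).
- case: (occ eta k); case: (occ eta k.+1); rewrite /= !(subrr, subr0, sub0r).
  + by ring.
  + by rewrite expr1z /t; field; rewrite ?p0 ?q0.
  + by rewrite exprN1 /t; field; rewrite ?p0 ?q0.
  + by ring.
- by rewrite /=; lia.
move=> y yB /=; rewrite occ_swap_occ //.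
by case: eqP => [->|]; [lia|]; case: eqP => [->|]; lia.
Qed.

Lemma Lseg_Hdual (alpha beta gamma delta : R) (s : state l) (x : weyl n l) :
  (2 <= l)%N -> rho0 = alpha / p -> rhol = delta / q ->
  alpha / p + gamma / q = 1 -> beta / p + delta / q = 1 ->
  Lseg p q alpha beta gamma delta (fun s' => Hdual p q s' x) s =
  (p - q) * Hdual p q s x *
  \sum_(y <- val x) (ext_occ s.1 y - ext_occ s.1 (y - 1)).
Proof.
move=> hl eq_rho0 eq_rhol hleft hright; case: s => eta N; rewrite /Lseg.
rewrite left_boundary_rate // -[X in X + \sum_(_ <= _ < _) _]addrA.
rewrite right_boundary_rate //.
under eq_big_nat do rewrite bulk_rate //.
rewrite -mulr_sumr -!mulrDr sum_weyl; congr (_ * _).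
(* The terms [z = l] and [z = 1] are the boundary rates; the others become bonds [k = z - 1]. *)
rewrite [in RHS]big_nat_recr /=; last lia.
rewrite [in RHS]big_ltn /=; last lia.
by rewrite [in RHS]big_add1 /= addrAC.
Qed.

End Duality.

Theorem theorem3p2 (R : realType) (l n : nat)
    (p q alpha beta gamma delta : R)
    (hl : (2 <= l)%N) (hn : (1 <= n)%N)
    (hq : 0 < q) (hqp : q < p)
    (halpha : 0 <= alpha) (hbeta : 0 <= beta)
    (hgamma : 0 <= gamma) (hdelta : 0 <= delta)
    (hleft : alpha / p + gamma / q = 1)
    (hright : beta / p + delta / q = 1)
    (s : state l) (x : weyl n l) :
  Lseg p q alpha beta gamma delta (fun s' : state l => Hdual p q s' x) s =
  Dop p q (alpha / p) (delta / q) (fun x' : weyl n l => Hdual p q s x') x.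
Proof.
have hp : 0 < p by exact: lt_trans hqp.
by rewrite Dop_Hdual //; apply: Lseg_Hdual.
Qed.
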